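(* Let $c,d>0$ be real, let $g(x)=xF(c,d;c+d;x)$ for $x\in(0,1)$, and let $$Q_g(x,y)=\frac{g(x)+g(y)}{g(x+y-xy)},\qquad x,y\in(0,1).$$ Then for all $x,y\in(0,1)$, $$0<Q_g(x,y)<2.$$
   Context: $F(a,b;c;x)=\sum_{n=0}^{\infty}\frac{(a,n)(b,n)}{(c,n)}\frac{x^n}{n!}$ for $|x|<1$ is the Gaussian hypergeometric function, where $(a,0)=1$ and $(a,n)=a(a+1)\cdots(a+n-1)$ for $n\ge 1$. Note that $x+y-xy\in(0,1)$ for $x,y\in(0,1)$. *)

(* Defs.v *)
From Stdlib Require Import Reals Factorial.
From Coquelicot Require Import Coquelicot.
Open Scope R_scope.

(** Shifted factorial [(a, n) = a (a + 1) ... (a + n - 1)], with [(a, 0) = 1]. *)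
Fixpoint poch (a : R) (n : nat) : R :=
  match n with
  | O => 1
  | S m => poch a m * (a + INR m)
  end.

(** [PSeries] is total; [hypergeom] is the Gaussian hypergeometric function
    only for [Rabs x < 1] and [c] not a nonpositive integer. *)
Definition hypergeom (a b c x : R) : R :=
  PSeries (fun n => poch a n * poch b n / poch c n / INR (fact n)) x.

Definition g (c d x : R) : R := x * hypergeom c d (c + d) x.

Definition Q (f : R -> R) (x y : R) : R := (f x + f y) / f (x + y - x * y).

(* Main.v *)
Require Import Defs.
From Stdlib Require Import Reals Lra Factorial.
From Coquelicot Require Import Coquelicot.
Open Scope R_scope.

(** The hypergeometric coefficients are positive, so [F] is nondecreasing on
    [[0, 1)] with [F >= F(0) = 1], and [g x = x F(x)] is strictly increasing.
    Since [x + y - x y] exceeds both [x] and [y], each of [g x], [g y] is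
    smaller than [g (x + y - x y)]. *)

(** Termwise comparison, since [x ^ n <= z ^ n]. The radius hypothesis makes the dominating series
    at [z] summable, as [Series_le] demands. *)
Lemma PSeries_le_nonneg (a : nat -> R) (x z : R) :
  (forall n, 0 <= a n) -> 0 <= x <= z -> Rbar_lt z (CV_radius a) ->
  PSeries a x <= PSeries a z.
Proof.
  intros Ha Hxz Hz.
  apply Series_le.
  - intros n; split.
    + apply Rmult_le_pos; [apply Ha | apply pow_le; lra].
    + apply Rmult_le_compat_l; [apply Ha | now apply pow_incr].
  - apply ex_series_Rabs, CV_disk_inside.
    now rewrite Rabs_pos_eq by lra.
Qed.

Lemma poch_pos (a : R) (n : nat) : 0 < a -> 0 < poch a n.
Proof.
  intros Ha; induction n as [|n IH]; simpl; [lra|].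
  apply Rmult_lt_0_compat; [exact IH|].
  pose proof (pos_INR n); lra.
Qed.

(** Written exactly as the sequence inside [hypergeom], so that the two are convertible. *)
Definition hyper_coeff (a b c : R) (n : nat) : R :=
  poch a n * poch b n / poch c n / INR (fact n).

Lemma hyper_coeff_pos (a b c : R) (n : nat) :
  0 < a -> 0 < b -> 0 < c -> 0 < hyper_coeff a b c n.
Proof.
  intros Ha Hb Hc; unfold hyper_coeff.
  apply Rdiv_lt_0_compat; [|apply INR_fact_lt_0].
  apply Rdiv_lt_0_compat; [|now apply poch_pos].
  now apply Rmult_lt_0_compat; apply poch_pos.
Qed.

(** The grouping yields two quotients of shifts of [INR n], each tending to 1; the shift by 1 comes
    from the factorial. *)
Lemma hyper_coeff_ratio (a b c : R) (n : nat) :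
  0 < a -> 0 < b -> 0 < c ->
  hyper_coeff a b c (S n) / hyper_coeff a b c n =
  (a + INR n) / (c + INR n) * ((b + INR n) / (1 + INR n)).
Proof.
  intros Ha Hb Hc; unfold hyper_coeff.
  rewrite fact_simpl, mult_INR, S_INR; simpl poch.
  pose proof (poch_pos a n Ha); pose proof (poch_pos b n Hb).
  pose proof (poch_pos c n Hc); pose proof (INR_fact_lt_0 n).
  pose proof (pos_INR n).
  field; repeat split; lra.
Qed.

Lemma is_lim_seq_shift_ratio (a b : R) :
  0 < b -> is_lim_seq (fun n => (a + INR n) / (b + INR n)) 1.
Proof.
  intros Hb.
  (* Splitting off the limit leaves a multiple of [/ (INR n + b)], which tends to 0. *)
  apply is_lim_seq_ext with (fun n => 1 + (a - b) * / (INR n + b)).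
  { intros n; pose proof (pos_INR n); field; lra. }
  replace (Finite 1) with (Finite (1 + (a - b) * 0)) by (f_equal; ring).
  apply is_lim_seq_plus'; [apply is_lim_seq_const|].
  apply is_lim_seq_mult'; [apply is_lim_seq_const|].
  change (Finite 0) with (Rbar_inv p_infty).
  apply is_lim_seq_inv; [|discriminate].
  eapply is_lim_seq_plus; [apply is_lim_seq_INR | apply is_lim_seq_const |].
  reflexivity.
Qed.

(** By d'Alembert's criterion: the coefficient ratios tend to 1, so the radius is [/ 1]. *)
Lemma CV_radius_hyper_coeff (a b c : R) :
  0 < a -> 0 < b -> 0 < c -> CV_radius (hyper_coeff a b c) = 1.
Proof.
  intros Ha Hb Hc.
  rewrite (CV_radius_finite_DAlembert _ 1); [f_equal; lra | | lra |].
  - intros n; pose proof (hyper_coeff_pos a b c n Ha Hb Hc); lra.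
  - apply is_lim_seq_ext with
      (fun n => (a + INR n) / (c + INR n) * ((b + INR n) / (1 + INR n))).
    { intros n; rewrite <- hyper_coeff_ratio by assumption.
      symmetry; apply Rabs_pos_eq, Rlt_le.
      now apply Rdiv_lt_0_compat; apply hyper_coeff_pos. }
    replace (Finite 1) with (Finite (1 * 1)) by (f_equal; ring).
    apply is_lim_seq_mult'; apply is_lim_seq_shift_ratio; lra.
Qed.

Lemma hypergeom_le (a b c x z : R) :
  0 < a -> 0 < b -> 0 < c -> 0 <= x <= z -> z < 1 ->
  hypergeom a b c x <= hypergeom a b c z.
Proof.
  intros Ha Hb Hc Hxz Hz.
  apply (PSeries_le_nonneg (hyper_coeff a b c)); [|exact Hxz|].
  - intros n; now apply Rlt_le, hyper_coeff_pos.
  - now rewrite CV_radius_hyper_coeff.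
Qed.

Lemma hypergeom_ge_1 (a b c x : R) :
  0 < a -> 0 < b -> 0 < c -> 0 <= x < 1 -> 1 <= hypergeom a b c x.
Proof.
  intros Ha Hb Hc Hx.
  replace 1 with (hypergeom a b c 0).
  - apply hypergeom_le; lra.
  - unfold hypergeom; rewrite PSeries_0; simpl; field.
Qed.

Lemma g_pos (c d x : R) : 0 < c -> 0 < d -> 0 < x < 1 -> 0 < g c d x.
Proof.
  intros Hc Hd Hx.
  pose proof (hypergeom_ge_1 c d (c + d) x Hc Hd ltac:(lra) ltac:(lra)).
  apply Rmult_lt_0_compat; lra.
Qed.

Lemma g_increasing (c d x z : R) :
  0 < c -> 0 < d -> 0 < x < z -> z < 1 -> g c d x < g c d z.
Proof.
  intros Hc Hd Hxz Hz; unfold g.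
  pose proof (hypergeom_ge_1 c d (c + d) x Hc Hd ltac:(lra) ltac:(lra)).
  pose proof (hypergeom_le c d (c + d) x z Hc Hd ltac:(lra) ltac:(lra) Hz).
  (* Enlarging the outer factor first gives strictness, because F(x) >= 1 > 0; enlarging the
     argument of F then needs only weak monotonicity. *)
  apply Rlt_le_trans with (z * hypergeom c d (c + d) x).
  - apply Rmult_lt_compat_r; lra.
  - apply Rmult_le_compat_l; lra.
Qed.

Theorem theorem3p3 (c d : R) (hc : 0 < c) (hd : 0 < d)
  (x y : R) (hx : 0 < x < 1) (hy : 0 < y < 1) :
  0 < Q (g c d) x y < 2.
Proof.
  (* With z = x + y - xy, these three products are 1 - z, z - x and z - y. *)
  assert (H1 : 0 < (1 - x) * (1 - y)) by (apply Rmult_lt_0_compat; lra).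
  assert (H2 : 0 < (1 - x) * y) by (apply Rmult_lt_0_compat; lra).
  assert (H3 : 0 < x * (1 - y)) by (apply Rmult_lt_0_compat; lra).
  pose proof (g_pos c d x hc hd hx); pose proof (g_pos c d y hc hd hy).
  unfold Q; set (z := x + y - x * y).
  assert (x < z /\ y < z /\ z < 1) as (Hxz & Hyz & Hz) by (unfold z; lra).
  pose proof (g_increasing c d x z hc hd ltac:(lra) Hz).
  pose proof (g_increasing c d y z hc hd ltac:(lra) Hz).
  (* The denominator is positive since [0 < g c d x < g c d z]; adding the two strict comparisons
     bounds the numerator by [2 * g c d z]. *)
  split.
  - apply Rdiv_lt_0_compat; lra.
  - apply Rlt_div_l; lra.
Qed.
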